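(* Let $\eta_t(\omega)$ be the random walk in random environment built from $\delta\in(0,1/2)$, $\alpha>0$ and the i.i.d. vectors $(\xi_i,Y_i)$ as described in the context. Suppose $\mathbb{P}[\xi_1=1/2]=1$, $\mathbb{E}[Y_1]>0$, $\sigma^2\in(0,\infty)$ and $\alpha\in(0,1)$. Then, for $\mathbb{P}$-a.e. $\omega$, for any $\varepsilon>0$, $P$-a.s., $$\eta_t(\omega)\le(1+\varepsilon)\left(\frac{1-\alpha}{4\mathbb{E}[Y_1]}\right)^{1/(1-\alpha)}(\log t)^{1/(1-\alpha)}$$ for all but finitely many $t$, and $$\eta_t(\omega)\ge(1-\varepsilon)\left(\frac{1-\alpha}{4\mathbb{E}[Y_1]}\right)^{1/(1-\alpha)}(\log t)^{1/(1-\alpha)}$$ for infinitely many $t$.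
   Context: Environment. Fix $\delta\in(0,1/2)$ and $\alpha>0$. Let $(\xi_i,Y_i)$, $i\in\mathbb{N}=\{1,2,\dots\}$, be i.i.d. random vectors on a probability space $(\Omega,\mathcal{F},\mathbb{P})$ (with expectation $\mathbb{E}$ and variance $\mathrm{Var}$) such that $\mathbb{P}[\delta\le\xi_1\le 1-\delta]=1$ and $Y_1$ takes values in $[-1,1]$. Set $p_0=q_0=1/2$ and, for $n\ge1$, let $p_n$ be the truncation of $\xi_n+Y_nn^{-\alpha}$ to $[\delta/2,1-\delta/2]$, i.e. $p_n=\xi_n+Y_nn^{-\alpha}$ if this lies in $[\delta/2,1-\delta/2]$, $p_n=\delta/2$ if $\xi_n+Y_nn^{-\alpha}<\delta/2$, and $p_n=1-\delta/2$ if $\xi_n+Y_nn^{-\alpha}>1-\delta/2$; let $q_n=1-p_n$. The environment is $\omega=(p_0,p_1,p_2,\dots)$. Walk. Given $\omega$, $(\eta_t(\omega);t\in\mathbb{Z}^+)$, $\mathbb{Z}^+=\{0,1,2,\dots\}$, is the Markov chain on $\mathbb{Z}^+$ under the quenched probability $P$ (depending on $\omega$), with $\eta_0(\omega)=r$ for some fixed $r\in\mathbb{Z}^+$ and transition probabilities: from $n\ge1$, to $n-1$ with probability $p_n$ and to $n+1$ with probability $q_n$; from $0$, to $0$ with probability $p_0$ and to $1$ with probability $q_0$. Notation. $\sigma^2=\mathrm{Var}[Y_1]$. *)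

(* Defs.v *)
(* MathComp-Analysis *)
From mathcomp Require Import all_boot all_order all_algebra.
From mathcomp Require Import all_classical all_reals all_analysis.

Set Implicit Arguments.
Unset Strict Implicit.
Unset Printing Implicit Defensive.

Import Order.TTheory GRing.Theory Num.Theory.
Import numFieldNormedType.Exports.

Local Open Scope classical_set_scope.
Local Open Scope ring_scope.

Definition mutually_independent d (Omega : measurableType d) (R : realType)
    (Pr : probability Omega R) d' (T : measurableType d')
    (I : set nat) (X : nat -> Omega -> T) : Prop :=
  forall (J : seq nat) (B : nat -> set T),
    uniq J -> [set` J] `<=` I -> (forall i, measurable (B i)) ->
    Pr (\bigcap_(i in [set` J]) (X i @^-1` B i)) =
    (\prod_(i <- J) Pr (X i @^-1` B i))%E.

Definition identically_distributed d (Omega : measurableType d) (R : realType)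
    (Pr : probability Omega R) d' (T : measurableType d')
    (I : set nat) (X : nat -> Omega -> T) : Prop :=
  forall (i j : nat) (B : set T), I i -> I j -> measurable B ->
    Pr (X i @^-1` B) = Pr (X j @^-1` B).

(* The families are indexed by {1, 2, ...}; the index 0 is unconstrained. *)
Definition iid d (Omega : measurableType d) (R : realType)
    (Pr : probability Omega R) d' (T : measurableType d')
    (X : nat -> Omega -> T) : Prop :=
  mutually_independent Pr [set i | (0 < i)%N] X /\
  identically_distributed Pr [set i | (0 < i)%N] X.

Definition truncate (R : realType) (a b x : R) : R :=
  if x < a then a else if b < x then b else x.

Definition environment (R : realType) (delta alpha : R) (xi Y : nat -> R)
    (n : nat) : R :=
  if n == 0%N then 2^-1
  else truncate (delta / 2) (1 - delta / 2) (xi n + Y n * n%:R `^ (- alpha)).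

Definition transition (R : realType) (p : nat -> R) (x y : nat) : R :=
  if x == 0%N then
    if y == 0%N then p 0%N else if y == 1%N then 1 - p 0%N else 0
  else
    if y == x.-1 then p x else if y == x.+1 then 1 - p x else 0.

(* The conditional-probability form of the Markov property, multiplied out so
   that histories of probability 0 need no separate treatment. *)
Definition markov_chain d (S : measurableType d) (R : realType)
    (P : probability S R) (Q : nat -> nat -> R) (r : nat)
    (eta : nat -> {RV P >-> nat}) : Prop :=
  P [set s | eta 0%N s = r] = 1%E /\
  forall (t : nat) (x : nat -> nat),
    P [set s | forall k, (k <= t.+1)%N -> eta k s = x k] =
    (P [set s | forall k, (k <= t)%N -> eta k s = x k] *
     (Q (x t) (x t.+1))%:E)%E.

(* Main.v *)
Require Import Defs.
From mathcomp Require Import all_boot all_order all_algebra.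
From mathcomp Require Import all_classical all_reals all_analysis.
From mathcomp Require Import measurable_realfun.
From mathcomp Require Import ring lra zify.

(** Write V(n) for the sum over 1 <= k <= n of ln (p_k / (1 - p_k)), b = 1 - alpha
    and c = 4 E[Y_1] / b. For small y, ln ((1/2 + y) / (1/2 - y)) = 4 y + O(y^2),
    so the strong law of large numbers and an Abel summation give
    V(n) = c n^b (1 + o(1)) almost surely.

    Fix such an environment and kill the chain when it leaves {0, ..., n}.
    Comparison with the reversible measure, of order e^{-V}, bounds the
    probability of leaving before time t by a constant times t e^{-V(n)}. The
    mean leaving time is O(n^2 e^{V(n) (1 + o(1))}), hence the probability of
    not leaving before time t is at most that mean divided by t. With
    t = exp (c theta n^b) both bounds are summable in n, for theta < 1 and
    theta > 1 respectively, and Borel-Cantelli over n yields the two halves of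
    the statement: theta = (1 + eps)^{-b} for the first one, and
    theta = (1 + eps)^b for the second one, as (1 - eps) (1 + eps) <= 1. *)

Set Implicit Arguments.
Unset Strict Implicit.
Unset Printing Implicit Defensive.

Import Order.TTheory GRing.Theory Num.Theory.
Import numFieldNormedType.Exports.

Local Open Scope classical_set_scope.
Local Open Scope ring_scope.

(** * Birth-and-death chains killed outside an interval *)

Section birth_death_chain.
Variables (R : realType) (p : nat -> R).
Hypothesis p01 : forall x, 0 < p x < 1.

Let p_gt0 x : 0 < p x. Proof. by case/andP: (p01 x). Qed.
Let q_gt0 x : 0 < 1 - p x. Proof. by case/andP: (p01 x); lra. Qed.

(** The sum starts at 1 because p 0 is a holding probability and not that of a step down. *)
Definition potential (n : nat) : R :=
  \sum_(1 <= k < n.+1) ln (p k / (1 - p k)).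

(** Normalised so that the edge between n and n + 1 has conductance e^{-V(n)}, computed from either
    endpoint. *)
Definition reversible_measure (n : nat) : R := expR (- potential n) / (1 - p n).

Lemma potentialS n :
  potential n.+1 = potential n + ln (p n.+1 / (1 - p n.+1)).
Proof. by rewrite /potential big_nat_recr. Qed.

Lemma reversible_measure_gt0 n : 0 < reversible_measure n.
Proof. by rewrite divr_gt0 ?expR_gt0. Qed.

Lemma reversible_measure_up n :
  reversible_measure n * (1 - p n) = expR (- potential n).
Proof. by rewrite /reversible_measure divfK // gt_eqF. Qed.

Lemma reversible_measure_down n :
  reversible_measure n.+1 * p n.+1 = expR (- potential n).
Proof.
rewrite /reversible_measure potentialS opprD expRD expRN expRN lnK ?posrE ?divr_gt0 //.
by field; rewrite !gt_eqF ?expR_gt0.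
Qed.

(** Since [0.-1] is 0, one formula also covers the holding step at 0. *)
Lemma transitionE x y :
  transition p x y = p x * (y == x.-1)%:R + (1 - p x) * (y == x.+1)%:R.
Proof.
rewrite /transition; case: x => [|x] /=; case: eqVneq => [->|_] /=.
- by rewrite mulr1 mulr0 addr0.
- by case: eqVneq => _; rewrite /= ?mulr0 ?mulr1 add0r.
- by rewrite (_ : x == x.+2 = false) ?mulr0 ?mulr1 ?addr0 //; lia.
- by case: eqVneq => _; rewrite /= ?mulr0 ?mulr1 add0r.
Qed.

Lemma transition_ge0 x y : 0 <= transition p x y.
Proof. by rewrite transitionE addr_ge0 // mulr_ge0 // ltW. Qed.

(** Distinct states that are not adjacent give 0 on both sides; on an edge both sides are its
    conductance. *)
Lemma detailed_balance x y :
  reversible_measure x * transition p x y =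
  reversible_measure y * transition p y x.
Proof.
wlog xy : x y / (x <= y)%N.
  by move=> H; case/orP: (leq_total x y) => /H // ->.
move: xy; rewrite leq_eqVlt => /orP[/eqP -> //|].
rewrite leq_eqVlt => /orP[/eqP <-|xy]; rewrite !transitionE !mulrDr.
  rewrite eqxx /= eqxx (_ : x == x.+2 = false); last by lia.
  rewrite mulr1 mulr0 mulr0 addr0 mulr1 reversible_measure_up reversible_measure_down.
  by rewrite (_ : x.+1 == x.-1 = false) ?mulr0 ?add0r //; lia.
rewrite (_ : y == x.-1 = false); last by lia.
rewrite (_ : y == x.+1 = false); last by lia.
rewrite (_ : x == y.-1 = false); last by lia.
rewrite (_ : x == y.+1 = false); last by lia.
by rewrite !mulr0.
Qed.

Lemma sum_delta_ord (n m : nat) (f : nat -> R) :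
  \sum_(y < n) (y == m :> nat)%:R * f y = (m < n)%:R * f m.
Proof.
case: ltnP => mn.
  rewrite (bigD1 (Ordinal mn)) //= eqxx big1 ?addr0 // => i.
  by rewrite -val_eqE /= => /negPf ->; rewrite mul0r.
rewrite mul0r big1 // => i _; rewrite (_ : (_ == _) = false) ?mul0r //.
by rewrite ltn_eqF // (leq_trans (ltn_ord i)).
Qed.

(** A step down, or the holding step at 0, stays below n, so only the step up carries an
    indicator. *)
Lemma sum_transition (n x : nat) (f : nat -> R) : (x < n)%N ->
  \sum_(y < n) transition p x y * f y =
  p x * f x.-1 + (1 - p x) * (x.+1 < n)%:R * f x.+1.
Proof.
move=> xn; under eq_bigr => y _ do rewrite transitionE mulrDl -!mulrA.
rewrite big_split /= -!mulr_sumr !sum_delta_ord -!mulrA; congr (_ * _ + _).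
by rewrite (_ : x.-1 < n)%N ?mul1r //; lia.
Qed.

Lemma row_sum_transition (n x : nat) : (x < n)%N ->
  \sum_(y < n) transition p x y = p x + (1 - p x) * (x.+1 < n)%:R.
Proof.
move=> /(sum_transition (fun=> 1)); under eq_bigr do rewrite mulr1.
by rewrite !mulr1.
Qed.

(* [b t x] is the mass at x at time t of the chain killed on leaving
   {0, ..., n}. *)
Section killed.
Variables (n : nat) (b : nat -> nat -> R).
Hypothesis b_ge0 : forall t x, (x < n.+1)%N -> 0 <= b t x.
Hypothesis b_rec : forall t y, (y < n.+1)%N ->
  b t.+1 y = \sum_(x < n.+1) b t x * transition p x y.

Let mass t := \sum_(x < n.+1) b t x.

Lemma killed_mean t (f : nat -> R) :
  \sum_(y < n.+1) b t.+1 y * f y =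
  \sum_(x < n.+1) b t x * \sum_(y < n.+1) transition p x y * f y.
Proof.
under eq_bigr => y _ do rewrite b_rec // mulr_suml.
rewrite exchange_big /=; apply: eq_bigr => x _.
by rewrite mulr_sumr; apply: eq_bigr => y _; rewrite mulrA.
Qed.

(** Mass is lost only through the step up from n. *)
Lemma killed_mass_step t : mass t.+1 = mass t - b t n * (1 - p n).
Proof.
have := killed_mean t (fun=> 1); under eq_bigr do rewrite mulr1.
rewrite -/(mass t.+1) => ->.
under eq_bigr => x _ do under eq_bigr do rewrite mulr1.
rewrite /mass [LHS]big_ord_recr [in RHS]big_ord_recr /= row_sum_transition //.
rewrite ltnn mulr0 addr0.
under eq_bigr => x _ do rewrite row_sum_transition ?ltnS ?(ltnW (ltn_ord x)) //
  ltn_ord mulr1 subrKC mulr1.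
ring.
Qed.

Lemma killed_mass_le t : mass t.+1 <= mass t.
Proof. by rewrite killed_mass_step gerBl mulr_ge0 ?b_ge0 // ltW. Qed.

(* By detailed balance the reversible measure is superharmonic for the killed
   chain, so the bound propagates in time. *)
Lemma killed_le_reversible (C : R) :
  (forall x, (x < n.+1)%N -> b 0 x <= C * reversible_measure x) ->
  0 <= C ->
  forall t x, (x < n.+1)%N -> b t x <= C * reversible_measure x.
Proof.
move=> b0 C0; elim=> // t IH y yn; rewrite b_rec //.
apply: (@le_trans _ _ (\sum_(x < n.+1) C * (reversible_measure y * transition p y x))).
  apply: ler_sum => x _; rewrite -detailed_balance mulrA.
  by rewrite ler_wpM2r ?transition_ge0 ?IH.
rewrite -!mulr_sumr ler_wpM2l // ler_piMr ?(ltW (reversible_measure_gt0 _)) //.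
rewrite row_sum_transition //; case: (_ < _)%N; rewrite ?mulr1 ?mulr0 ?addr0.
  by rewrite subrKC.
by case/andP: (p01 y) => _ /ltW.
Qed.

(** The loss in one step is the flow through the edge above n. As b t n is at most C times the
    reversible measure, that flow is at most C e^{-V(n)}. *)
Lemma killed_exit_le (C : R) :
  (forall x, (x < n.+1)%N -> b 0 x <= C * reversible_measure x) ->
  0 <= C ->
  forall T, mass 0 - mass T <= T%:R * (C * expR (- potential n)).
Proof.
move=> b0 C0; elim=> [|T IH]; first by rewrite mul0r subrr.
rewrite killed_mass_step -reversible_measure_up.
have := killed_le_reversible b0 C0 T (leqnn n.+1).
rewrite -(ler_pM2r (q_gt0 n)) => bn.
by move: IH; rewrite -reversible_measure_up -(natr1 T) (mulrDl T%:R); lra.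
Qed.

(** This is the mean time from y to y + 1: the resistance of the edge above y times the reversible
    mass of {0, ..., y}. *)
Definition hitting_increment (y : nat) : R :=
  expR (potential y) * \sum_(j < y.+1) reversible_measure j.

(* The expected time for the chain to leave {0, ..., n} from x; only the
   one-step equation [transition_hitting_mean] is needed. *)
Definition hitting_mean (x : nat) : R :=
  \sum_(x <= y < n.+1) hitting_increment y.

Lemma hitting_increment_ge0 y : 0 <= hitting_increment y.
Proof.
rewrite mulr_ge0 ?expR_ge0 // sumr_ge0 // => j _.
exact/ltW/reversible_measure_gt0.
Qed.

(** First-step analysis: a step down from y must be repaid by a passage from y - 1 to y. The
    indicator removes that term at y = 0, where [y.-1] would be 0 again. In the formula, the summand
    j = y yields the 1. *)
Lemma hitting_increment_rec y :
  (1 - p y) * hitting_increment y =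
  1 + p y * (hitting_increment y.-1 * (0 < y)%:R).
Proof.
rewrite /hitting_increment.
have e : reversible_measure y * (1 - p y) * expR (potential y) = 1.
  by rewrite reversible_measure_up mulrC expRxMexpNx_1.
rewrite big_ord_recr /=; set S := \sum_(i < y) _.
transitivity (1 + (1 - p y) * expR (potential y) * S).
  by rewrite -{2}e; ring.
congr (1 + _); rewrite /S.
case: y {e S} => [|y] /=; first by rewrite big_ord0 !mulr0.
rewrite mulr1 mulrA; congr (_ * _).
rewrite potentialS expRD lnK ?posrE ?divr_gt0 //; field.
by rewrite gt_eqF.
Qed.

Lemma hitting_mean_step x : (x <= n)%N ->
  hitting_mean x = hitting_increment x + hitting_mean x.+1.
Proof. by move=> xn; rewrite /hitting_mean big_ltn. Qed.

Lemma hitting_mean_out : hitting_mean n.+1 = 0.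
Proof. by rewrite /hitting_mean big_geq. Qed.

Lemma transition_hitting_mean x : (x < n.+1)%N ->
  \sum_(y < n.+1) transition p x y * hitting_mean y = hitting_mean x - 1.
Proof.
move=> xn; rewrite sum_transition //.
have -> : (1 - p x) * (x.+1 < n.+1)%:R * hitting_mean x.+1 =
          (1 - p x) * hitting_mean x.+1.
  rewrite -mulrA; congr (_ * _).
  have := xn; rewrite ltnS leq_eqVlt => /orP[/eqP ->|xn'].
    by rewrite hitting_mean_out mulr0.
  by rewrite ltnS xn' mul1r.
have h1 := hitting_increment_rec x.
have h2 := hitting_mean_step xn.
case: x xn h1 h2 => [|x] xn /= h1 h2.
  by move: h1; rewrite !mulr0 addr0 => h1; rewrite h2; nra.
have h3 := hitting_mean_step (ltnW xn).
by move: h1; rewrite mulr1 h3 h2 => h1; nra.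
Qed.

Lemma hitting_mean_le x : (x < n.+1)%N -> hitting_mean x <= hitting_mean 0.
Proof.
move=> xn; rewrite {2}/hitting_mean (@big_cat_nat _ _ _ x) //=; last exact: ltnW.
by rewrite lerDr sumr_ge0 // => y _; exact: hitting_increment_ge0.
Qed.

(** The mean of [hitting_mean] under b t drops by exactly [mass t] at each step, so the masses sum
    to at most its initial value. As they are nonincreasing, T times the last one obeys the same
    bound. *)
Lemma killed_survival_le T :
  mass 0 = 1 -> T%:R * mass T <= hitting_mean 0.
Proof.
move=> m0; pose g t := \sum_(x < n.+1) b t x * hitting_mean x.
have gS t : g t.+1 = g t - mass t.
  rewrite /g killed_mean /mass -sumrB; apply: eq_bigr => x _.
  by rewrite transition_hitting_mean // mulrBr mulr1.
have g_ge0 t : 0 <= g t.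
  by apply: sumr_ge0 => x _; rewrite mulr_ge0 ?b_ge0 // sumr_ge0 // => y _;
    exact: hitting_increment_ge0.
have main : T%:R * mass T + g T <= g 0.
  elim: T => [|T IH]; first by rewrite mul0r add0r.
  apply: le_trans IH; rewrite gS -(natr1 T).
  have : T.+1%:R * mass T.+1 <= T.+1%:R * mass T.
    by rewrite ler_wpM2l ?killed_mass_le.
  rewrite -(natr1 T); lra.
have : g 0 <= hitting_mean 0.
  rewrite -[leRHS]mul1r -m0 /mass mulr_suml; apply: ler_sum => x _.
  by rewrite ler_wpM2l ?b_ge0 ?hitting_mean_le.
by have := g_ge0 T; lra.
Qed.

End killed.

End birth_death_chain.

(** * From the Markov property on paths to the recursion of the killed chain *)

Section killed_chain.
Context d (S : measurableType d) (R : realType) (P : probability S R).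
Variables (Q : nat -> nat -> R) (r : nat) (eta : nat -> {RV P >-> nat}).
Hypothesis eta_markov : markov_chain Q r eta.

Lemma measurable_state k (B : set nat) : measurable [set s | B (eta k s)].
Proof. by rewrite -[X in measurable X]setTI; exact: measurable_funP. Qed.

Lemma measurable_history t (B : nat -> set nat) :
  measurable [set s | forall k, (k <= t)%N -> B k (eta k s)].
Proof.
rewrite (_ : [set _ | _] =
    \bigcap_(k in [set k | (k <= t)%N]) [set s | B k (eta k s)]) //.
by apply: bigcap_measurable => [|k _]; [exists 0%N|exact: measurable_state].
Qed.

Lemma measure_state_lt (A : set S) k n : measurable A ->
  P (A `&` [set s | (eta k s < n)%N]) =
  (\sum_(i < n) P (A `&` [set s | eta k s = i]))%E.
Proof.
move=> mA; elim: n => [|n IH].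
  by rewrite big_ord0 (_ : _ `&` _ = set0) ?measure0 //; apply/seteqP; split => s [].
rewrite big_ord_recr /= -IH -measureU.
- congr (P _); apply/seteqP; split => s /=.
    by move=> [As]; rewrite ltnS leq_eqVlt => /orP[/eqP|]; [right|left].
  by move=> [[As /ltnW]//|[As ->]]; split.
- exact: measurableI (measurable_state _ [set i | (i < n)%N]).
- exact: measurableI (measurable_state _ [set n]).
- by apply/seteqP; split => s //= [[_ +] [_ e]]; rewrite e ltnn.
Qed.

(* Coordinates before j are only confined to {0, ..., n-1}, the later ones are
   prescribed: raising j one step at a time turns the path form of the Markov
   property into the one-step recursion [killed_rec]. *)
Definition history n j t (x : nat -> nat) : set S :=
  [set s | forall k, (k <= t)%N ->
    if (k < j)%N then is_true (eta k s < n)%N else eta k s = x k].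

Lemma history_split n j t (x : nat -> nat) : (j <= t)%N ->
  P (history n j.+1 t x) =
  (\sum_(i < n) P (history n j t (fun k => if k == j then (i : nat) else x k)))%E.
Proof.
move=> jt.
(* [B] imposes every constraint except the one at time j, where the two sides differ. *)
pose B k := [set i | k != j -> if (k < j)%N then is_true (i < n)%N else i = x k].
have := measure_state_lt j n (measurable_history t B).
set A := [set s | forall k, _] => e.
transitivity (P (A `&` [set s | (eta j s < n)%N])).
  congr (P _); apply/seteqP; split => s.
    move=> h; split; last by have := h j jt; rewrite ltnSn.
    move=> k kt kj; have := h k kt; rewrite ltnS leq_eqVlt (negPf kj).
    by [].
  move=> [h hj] k kt; rewrite ltnS leq_eqVlt; have := h k kt; rewrite /B /=.
  by case: eqVneq => [-> _ //|kj /(_ isT)].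
rewrite e; apply: eq_bigr => i _; congr (P _); apply/seteqP; split => s.
  move=> [h hj] k kt; have := h k kt; rewrite /B /=.
  by case: eqVneq => [-> _|kj /(_ isT) //]; rewrite ltnn.
move=> h; split; last by have := h j jt; rewrite ltnn eqxx.
by move=> k kt kj; have := h k kt; rewrite (negPf kj).
Qed.

(** Releasing coordinate j means summing over its value. This is done only for j < t, so the factor
    in x t and x t.+1 is common to all terms. For j = 0 the claim is the Markov hypothesis. *)
Lemma history_markov n j t (x : nat -> nat) : (j <= t)%N ->
  P (history n j t.+1 x) = (P (history n j t x) * (Q (x t) (x t.+1))%:E)%E.
Proof.
elim: j x => [|j IH] x jt; first exact: eta_markov.2.
rewrite !history_split ?(ltnW jt) ?(leq_trans (ltnW jt)) //.
rewrite ge0_sume_distrl //; apply: eq_bigr => i _.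
rewrite (IH _ (ltnW jt)).
have -> : (t == j) = false by rewrite gtn_eqF.
by have -> : (t.+1 == j) = false by rewrite gtn_eqF // ltnW.
Qed.

Definition confined n t : set S :=
  [set s | forall k, (k <= t)%N -> (eta k s < n)%N].

Definition killed n t x : R := fine (P (confined n t `&` [set s | eta t s = x])).

Lemma measurable_confined n t : measurable (confined n t).
Proof. exact: (measurable_history t (fun=> [set i | (i < n)%N])). Qed.

Lemma killedE n t x : (x < n)%N ->
  P (history n t t (fun=> x)) = (killed n t x)%:E.
Proof.
move=> xn; rewrite /killed fineK ?fin_num_measure //; last first.
  exact: measurableI (measurable_confined _ _) (measurable_state _ [set x]).
congr (P _); apply/seteqP; split => s.
  move=> h; have e : eta t s = x by have := h t (leqnn t); rewrite ltnn.
  split => // k; rewrite leq_eqVlt => /orP[/eqP ->|kt]; first by rewrite e.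
  by move: (h k (ltnW kt)); rewrite kt.
move=> [h e] k kt; case: ltnP => [_|tk]; first exact: h.
by have -> : k = t by apply/eqP; rewrite eqn_leq kt tk.
Qed.

Lemma killed_ge0 n t x : 0 <= killed n t x.
Proof. exact/fine_ge0/measure_ge0. Qed.

Lemma sum_killed n t : \sum_(x < n) killed n t x = fine (P (confined n t)).
Proof.
apply: EFin_inj; rewrite fineK ?fin_num_measure //; last exact: measurable_confined.
rewrite -sumEFin -[in RHS](_ : confined n t `&` [set s | (eta t s < n)%N] = confined n t).
  rewrite measure_state_lt; last exact: measurable_confined.
  apply: eq_bigr => i _; rewrite /killed fineK // fin_num_measure //.
  exact: measurableI (measurable_confined _ _) (measurable_state _ [set (i : nat)]).
by apply/seteqP; split => s => [[]//|h]; split => //; exact: h.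
Qed.

Lemma killed_rec n t y : (y < n)%N ->
  killed n t.+1 y = \sum_(x < n) killed n t x * Q x y.
Proof.
(* Splitting according to the position at time t brings the event into the form treated by
   [history_markov]. *)
move=> yn; apply: EFin_inj; rewrite -killedE // history_split // -sumEFin.
apply: eq_bigr => x _; rewrite EFinM -killedE //.
rewrite history_markov // eqxx gtn_eqF //; congr (P _ * _)%E.
apply/seteqP; split => s h k kt; have := h k kt;
  case: ltnP => // tk; have -> : k = t by apply/eqP; rewrite eqn_leq kt tk.
  by rewrite eqxx.
by rewrite eqxx.
Qed.

Lemma killed0 n x : killed n 0 x <= (x == r)%:R.
Proof.
have m0 y : measurable [set s | eta 0 s = y] by exact: measurable_state _ [set y].
have mI : measurable (confined n 0 `&` [set s | eta 0 s = x]).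
  exact: measurableI (measurable_confined _ _) (m0 x).
have fin : P (confined n 0 `&` [set s | eta 0 s = x]) \is a fin_num.
  by rewrite fin_num_measure.
rewrite -lee_fin fineK //; case: eqVneq => [_|xr]; first exact: probability_le1.
apply: (@le_trans _ _ (P (~` [set s | eta 0 s = r]))).
  apply: le_measure; rewrite ?inE //; first exact: measurableC.
  by move=> s [_ /= ->]; exact/eqP.
by rewrite probability_setC // eta_markov.1 subee.
Qed.

Lemma sum_killed0 n : (r < n)%N -> \sum_(x < n) killed n 0 x = 1.
Proof.
move=> rn; rewrite sum_killed; apply: EFin_inj.
have m0 : measurable [set s | eta 0 s = r] by exact: measurable_state _ [set r].
have mc := measurable_confined n 0.
rewrite fineK ?fin_num_measure //; apply/eqP; rewrite eq_le probability_le1 //=.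
rewrite -eta_markov.1; apply: le_measure; rewrite ?inE //.
by move=> s /= e k; rewrite leqn0 => /eqP ->; rewrite e.
Qed.

End killed_chain.

(** * Borel-Cantelli estimates for a fixed environment *)

Section stretched_exponential.
Variable R : realType.

Lemma ln_le_powR (b e : R) : 0 < b -> 0 < e ->
  exists C : R, forall x, 0 < x -> ln x <= e * x `^ b + C.
Proof.
(* With y = x^{b/2}, ln x = (2/b) ln y <= (2/b) y, and this constant makes e y^2 + C - (2/b) y a
   perfect square. *)
move=> b0 e0; exists (e^-1 / (b * b)) => x x0.
set y := x `^ (b / 2).
have y0 : 0 < y by exact: powR_gt0.
have yy : x `^ b = y * y by rewrite -powRD ?gt_eqF // ?implybT // -splitr.
have -> : ln x = (2 / b) * ln y by rewrite /y ln_powR; field; rewrite gt_eqF.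
have h : ln y <= y.
  have : ln (1 + (y - 1)) <= y - 1 by apply: le_ln1Dx; lra.
  by rewrite subrKC; lra.
rewrite yy.
have -> : e * (y * y) + e^-1 / (b * b) =
  e * (y - (e * b)^-1) ^+ 2 + 2 / b * y.
  by field; rewrite !gt_eqF.
apply: (@le_trans _ _ (2 / b * y)); first by rewrite ler_wpM2l // divr_ge0 // ltW.
by rewrite lerDr mulr_ge0 ?sqr_ge0 // ltW.
Qed.

Lemma exprn_le_expR_powR (b e : R) (m : nat) : 0 < b -> 0 < e ->
  exists2 C : R, 0 < C &
    forall n : nat, n.+1%:R ^+ m <= C * expR (e * n.+1%:R `^ b).
Proof.
(* The m-th power multiplies the slope by m; dividing by m + 1 keeps the result at most e and also
   covers m = 0. *)
move=> b0 e0; have e1 : 0 < e / m.+1%:R by rewrite divr_gt0.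
have [C hC] := ln_le_powR b0 e1.
exists (expR (m%:R * C)); first exact: expR_gt0.
move=> n; have n0 : 0 < n.+1%:R :> R by [].
rewrite -expRD -[X in X ^+ m]lnK // -expRM_natl ler_expR.
apply: (@le_trans _ _ (m%:R * (e / m.+1%:R * n.+1%:R `^ b + C))).
  by rewrite ler_wpM2l ?hC.
rewrite mulrDr addrC lerD2l mulrA ler_wpM2r ?powR_ge0 //.
rewrite mulrCA ger_pMr // ler_pdivrMr // mul1r ler_nat; lia.
Qed.

Variables (b c k m : R).
Hypotheses (b0 : 0 < b) (c0 : 0 < c) (k0 : 0 < k) (m0 : 0 <= m).

Let powR_cancel : (c * k `^ b * m `^ b) `^ b^-1 = c `^ b^-1 * k * m.
Proof.
rewrite !powRM ?mulr_ge0 ?powR_ge0 ?(ltW c0) // -!powRrM.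
by rewrite divff ?gt_eqF // !powRr1 ?(ltW k0).
Qed.

Let powR_inv_gt0 : 0 < c `^ b^-1. Proof. exact: powR_gt0. Qed.

Let invr_powR : c^-1 `^ b^-1 = (c `^ b^-1)^-1.
Proof. by rewrite -[c^-1]powR_inv1 ?(ltW c0) // -powRrM mulN1r powRN. Qed.

Let arg_ge0 : 0 <= c * k `^ b * m `^ b.
Proof. by rewrite !mulr_ge0 ?powR_ge0 // ltW. Qed.

(** For L = ln t this turns a comparison of t with exp (c k^b m^b) into a bound on the position m.
    It is applied with k = (1 + eps)^{-1}, and its counterpart [le_powR_inv] with k = 1 + eps. *)
Lemma powR_inv_le (L : R) :
  c * k `^ b * m `^ b <= L -> m <= k^-1 * c^-1 `^ b^-1 * L `^ b^-1.
Proof.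
move=> h; have L0 := le_trans arg_ge0 h.
have : (c * k `^ b * m `^ b) `^ b^-1 <= L `^ b^-1.
  by rewrite ge0_ler_powR ?nnegrE ?invr_ge0 ?(ltW b0).
rewrite powR_cancel => e; rewrite invr_powR -(ler_pM2l (mulr_gt0 powR_inv_gt0 k0)).
by rewrite (_ : _ * (_ * L `^ b^-1) = L `^ b^-1) //; field; rewrite !gt_eqF.
Qed.

Lemma le_powR_inv (L : R) : 0 <= L ->
  L <= c * k `^ b * m `^ b -> c^-1 `^ b^-1 * L `^ b^-1 <= k * m.
Proof.
move=> L0 h; have : L `^ b^-1 <= (c * k `^ b * m `^ b) `^ b^-1.
  by rewrite ge0_ler_powR ?nnegrE ?invr_ge0 ?(ltW b0).
rewrite powR_cancel => e; rewrite invr_powR -(ler_pM2l powR_inv_gt0) mulrA.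
by rewrite divff ?gt_eqF // mul1r mulrA.
Qed.

End stretched_exponential.

(** * The Borel-Cantelli lemma for quadratically decaying probabilities *)

Section borel_cantelli.
Context d (T : measurableType d) (R : realType) (P : probability T R).

Lemma sum_inv_sqr_le (N : nat) : \sum_(k < N) (k.+1%:R ^+ 2)^-1 <= 2 :> R.
Proof.
(* The correction 1/(n + 1) makes the induction close, since 1/(n + 2)^2 <= 1/(n + 1) - 1/(n +
   2). *)
have H n : \sum_(k < n.+1) (k.+1%:R ^+ 2)^-1 <= 2 - n.+1%:R^-1 :> R.
  elim: n => [|n IH]; first by rewrite big_ord1 expr1n invr1; lra.
  rewrite big_ord_recr /=; apply: le_trans (lerD IH (lexx _)) _.
  rewrite -[n.+2%:R]natr1; set x : R := n.+1%:R.
  have x0 : 0 < x by [].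
  have x1 : 0 < x + 1 by rewrite addr_gt0.
  rewrite -subr_ge0 (_ : _ - _ = (x * (x + 1) ^+ 2)^-1).
    by rewrite invr_ge0 mulr_ge0 ?exprn_ge0 // ltW.
  by field; rewrite !gt_eqF.
case: N => [|n]; first by rewrite big_ord0.
by rewrite (le_trans (H n)) // gerBl invr_ge0.
Qed.

Lemma ae_eventually_notin (F : nat -> set T) (n0 : nat) (C : R) :
  (forall n, measurable (F n)) ->
  (forall n, (n0 <= n)%N -> fine (P (F n)) <= C / n.+1%:R ^+ 2) ->
  \forall s \ae P, exists N, forall n, (N <= n)%N -> ~ F n s.
Proof.
(* Emptying the first n0 events leaves the tail unchanged and extends the bound to every n. *)
move=> mF PF; pose G n := if (n0 <= n)%N then F n else set0.
have mG n : measurable (G n) by rewrite /G; case: ifP.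
(* A negative C would make the probability of [F n0] negative. *)
have [C0|C0] := leP 0 C; last first.
  have := PF n0 (leqnn _).
  have : 0 <= fine (P (F n0)) by exact/fine_ge0/measure_ge0.
  have : C / n0.+1%:R ^+ 2 < 0 by rewrite pmulr_llt0 // invr_gt0 exprn_gt0.
  by move=> h1 h2 h3; have := le_lt_trans (le_trans h2 h3) h1; rewrite ltxx.
have PG n : (P (G n) <= (C / n.+1%:R ^+ 2)%:E)%E.
  rewrite /G; case: ifP => [nn|_].
    by rewrite -[leLHS]fineK ?fin_num_measure // lee_fin PF.
  by rewrite measure0 lee_fin divr_ge0 // exprn_ge0.
have G0 : P (lim_sup_set G) = 0%E.
  apply: lim_sup_set_cvg0 => //.
  apply: (@le_lt_trans _ _ (C * 2)%:E); last exact: ltry.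
  apply: lime_le; first by apply: is_cvg_nneseries => n _ _; exact: measure_ge0.
  near=> n; rewrite big_mkord.
  apply: (@le_trans _ _ (\sum_(k < n) (C / k.+1%:R ^+ 2)%:E)%E).
    by apply: lee_sum => k _; exact: PG.
  by rewrite sumEFin lee_fin -mulr_sumr ler_wpM2l // sum_inv_sqr_le.
have nG : P.-negligible (lim_sup_set G).
  exists (lim_sup_set G); split => //.
  by apply: bigcap_measurable => [|k _]; [exists 0%N|exact: bigcup_measurable].
apply: negligibleS nG => s /= h N _ /=; apply: contrapT => h'; apply: h; exists (maxn N n0) => n.
rewrite geq_max => /andP[Nn n0n] Fs; apply: h'; exists n => //.
by rewrite /G n0n.
Unshelve. all: by end_near. Qed.

End borel_cantelli.

(** * Exit times from {0, ..., n} in a fixed environment *)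

Section quenched.
Variables (R : realType) (p : nat -> R) (kappa b c : R) (r : nat).
Hypotheses (p01 : forall x, 0 < p x < 1) (kappa0 : 0 < kappa).
Hypothesis p_le : forall x, kappa <= 1 - p x.
Hypotheses (b0 : 0 < b) (c0 : 0 < c).
Hypothesis potential_asymp : forall e, 0 < e -> exists C, forall n,
  `|potential p n - c * n.+1%:R `^ b| <= e * n.+1%:R `^ b + C.
Context d (S : measurableType d) (P : probability S R).
Variable eta : nat -> {RV P >-> nat}.
Hypothesis eta_markov : markov_chain (transition p) r eta.

Let surv n t := fine (P (confined eta n.+1 t)).

Let T theta n := Num.truncn (expR (c * theta * n.+1%:R `^ b)).

(** The constant scales the reversible measure to 1 at the starting point r. *)
Let killed0_le n : forall x, (x < n.+1)%N ->
  killed eta n.+1 0 x <= (reversible_measure p r)^-1 * reversible_measure p x.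
Proof.
move=> x _; apply: le_trans (killed0 eta_markov _ _) _.
have rp := reversible_measure_gt0 p01.
case: eqVneq => [->|_]; first by rewrite mulVf ?gt_eqF.
by rewrite mulr_ge0 ?invr_ge0 // ltW.
Qed.

Lemma exit_probability_le n t : (r <= n)%N ->
  1 - surv n t <= t%:R * ((reversible_measure p r)^-1 * expR (- potential p n)).
Proof.
move=> rn.
have rp : 0 <= (reversible_measure p r)^-1.
  by rewrite invr_ge0 ltW // reversible_measure_gt0.
have := killed_exit_le p01
  (fun t y => @killed_rec _ _ _ _ _ _ _ eta_markov n.+1 t y) (@killed0_le n) rp t.
by rewrite (sum_killed0 eta_markov) // sum_killed.
Qed.

Lemma survival_probability_le n t : (r <= n)%N ->
  t%:R * surv n t <= hitting_mean p n 0.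
Proof.
move=> rn; rewrite /surv -sum_killed.
apply: (killed_survival_le p01 (fun t x _ => killed_ge0 eta n.+1 t x)
  (fun t y => @killed_rec _ _ _ _ _ _ _ eta_markov n.+1 t y)).
exact: (sum_killed0 eta_markov).
Qed.

(** Allowing an error of slope c cancels the growth term and leaves only the constant. *)
Lemma potential_lower : exists C, forall n, - C <= potential p n.
Proof.
have [C hC] := potential_asymp c0; exists C => n.
by have := hC n; rewrite ler_norml => /andP[]; lra.
Qed.

(** There are n + 1 increments. Each is e^{V(y)} times a sum of at most n + 1 masses, which are
    bounded because V is bounded below and 1 - p x >= kappa. Hence the power 2. *)
Lemma hitting_mean_le_expR e : 0 < e -> exists2 C, 0 < C & forall n,
  hitting_mean p n 0 <= C * n.+1%:R ^+ 2 * expR ((c + e) * n.+1%:R `^ b).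
Proof.
move=> e0; have [C1 h1] := potential_lower; have [C2 h2] := potential_asymp e0.
exists (kappa^-1 * expR C1 * expR C2) => [|n].
  by rewrite !mulr_gt0 ?expR_gt0 ?invr_gt0.
have rp j : reversible_measure p j <= kappa^-1 * expR C1.
  rewrite mulrC ler_pM ?expR_ge0 ?invr_ge0 ?(le_trans (ltW kappa0)) //.
    by rewrite ler_expR lerNl h1.
  by rewrite lef_pV2 ?posrE ?(lt_le_trans kappa0).
have hi y : (y < n.+1)%N -> hitting_increment p y <=
    expR ((c + e) * n.+1%:R `^ b) * expR C2 * (kappa^-1 * expR C1 * n.+1%:R).
  move=> yn; rewrite ler_pM ?expR_ge0 ?sumr_ge0 //.
  - by move=> j _; exact/ltW/reversible_measure_gt0.
  - rewrite -expRD ler_expR.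
    have : y.+1%:R `^ b <= n.+1%:R `^ b :> R.
      by rewrite ge0_ler_powR ?nnegrE ?ler_nat // ltW.
    rewrite -(ler_pM2l (addr_gt0 c0 e0)).
    by have := h2 y; rewrite ler_norml => /andP[_]; lra.
  - apply: (@le_trans _ _ (\sum_(j < y.+1) kappa^-1 * expR C1)).
      by apply: ler_sum => j _.
    rewrite sumr_const card_ord -[leLHS]mulr_natr ler_wpM2l ?ler_nat //.
    by rewrite mulr_ge0 ?expR_ge0 ?invr_ge0 ?ltW.
apply: le_trans (ler_sum_nat _) _.
  by move=> y /andP[_ yn]; exact: hi.
rewrite sumr_const_nat subn0 -[leLHS]mulr_natr.
by rewrite le_eqVlt; apply/orP; left; apply/eqP; ring.
Qed.

Lemma ae_confined theta : 0 < theta < 1 ->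
  \forall s \ae P, exists N, forall n, (N <= n)%N ->
    confined eta n.+1 (T theta n) s.
Proof.
(* Twice e is the gap c (1 - theta): one half absorbs the error of the potential, the other pays for
   the factor (n + 1)^2 in [bound]. *)
move=> /andP[t0 t1]; pose e := c * (1 - theta) / 2.
have e0 : 0 < e by rewrite divr_gt0 // mulr_gt0 // subr_gt0.
have [C hC] := potential_asymp e0.
have [K K0 hK] := @exprn_le_expR_powR R b e 2 b0 e0.
have rp := reversible_measure_gt0 p01 r.
have mc n t : measurable (confined eta n t) by exact: measurable_confined.
have bound n : (r <= n)%N -> fine (P (~` confined eta n.+1 (T theta n))) <=
    (reversible_measure p r)^-1 * expR C * K / n.+1%:R ^+ 2.
  move=> rn; rewrite probability_setC // fineB ?fin_num_measure //=.
  apply: le_trans (exit_probability_le _ rn) _.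
  set x := n.+1%:R `^ b; have n0 : 0 < n.+1%:R ^+ 2 :> R by rewrite exprn_gt0.
  rewrite ler_pdivlMr //.
  apply: (@le_trans _ _ (expR (c * theta * x) * ((reversible_measure p r)^-1 *
      expR (- potential p n)) * (K * expR (e * x)))).
    have h0 : 0 <= (reversible_measure p r)^-1 * expR (- potential p n).
      by rewrite mulr_ge0 ?invr_ge0 ?expR_ge0 ?(ltW rp).
    apply: ler_pM; [by rewrite mulr_ge0|exact: ltW| |exact: hK].
    by rewrite ler_wpM2r // truncn_le expR_ge0.
  have -> : expR (c * theta * x) * ((reversible_measure p r)^-1 *
      expR (- potential p n)) * (K * expR (e * x)) =
    (reversible_measure p r)^-1 * (expR (c * theta * x) * expR (- potential p n) *
      expR (e * x)) * K by ring.
  rewrite ler_wpM2r ?(ltW K0) // ler_wpM2l ?invr_ge0 ?(ltW rp) //.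
  rewrite -!expRD ler_expR.
  by have := hC n; rewrite -/x ler_norml /e => /andP[+ _]; lra.
have := ae_eventually_notin (fun n => measurableC (mc n.+1 (T theta n))) bound.
by apply: filterS => s [N h]; exists N => n /h /= /contrapT.
Qed.

Lemma ae_not_confined theta : 1 < theta ->
  \forall s \ae P, exists N, forall n, (N <= n)%N ->
    ~ confined eta n.+1 (T theta n) s.
Proof.
(* Half of the gap c (theta - 1) goes into the error for the mean exit time, the other half remains
   as decay. *)
move=> t1; pose e := c * (theta - 1) / 2.
have e0 : 0 < e by rewrite divr_gt0 // mulr_gt0 // subr_gt0.
have [C C0 hC] := hitting_mean_le_expR e0.
(* Power 4: two for the mean exit time and two for summability. *)
have [K K0 hK] := @exprn_le_expR_powR R b e 4 b0 e0.
have bound n : (r <= n)%N -> fine (P (confined eta n.+1 (T theta n))) <=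
    (C + 1) * K / n.+1%:R ^+ 2.
  move=> rn; set x := n.+1%:R `^ b.
  have n0 : 0 < n.+1%:R ^+ 2 :> R by rewrite exprn_gt0.
  have x0 : 0 <= x by exact: powR_ge0.
  have s1 : surv n (T theta n) <= 1.
    rewrite -lee_fin fineK ?fin_num_measure ?probability_le1 //;
    exact: measurable_confined.
  have s0 : 0 <= surv n (T theta n) by exact/fine_ge0/measure_ge0.
  have h1 := survival_probability_le (T theta n) rn.
  have h2 := hC n.
  have tT : expR (c * theta * x) <= (T theta n)%:R + 1.
    by rewrite natr1 ltW // truncnS_gt.
  rewrite -/x in h2.
  (* Truncating to an integer time costs one extra [surv], at most 1, which turns C into C + 1. *)
  have h3 : expR (c * theta * x) * surv n (T theta n) <=
      (C + 1) * n.+1%:R ^+ 2 * expR ((c + e) * x).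
    apply: (@le_trans _ _ (((T theta n)%:R + 1) * surv n (T theta n))).
      by rewrite ler_wpM2r.
    have : 1 <= n.+1%:R ^+ 2 * expR ((c + e) * x).
      rewrite mulr_ege1 ?exprn_ege1 ?ler1n // -expR0 ler_expR mulr_ge0 //.
      by rewrite addr_ge0 // ltW.
    by set y := _ ^+ 2 in h2 *; set E := expR _ in h2 *; lra.
  rewrite ler_pdivlMr // -(ler_pM2l (expR_gt0 (c * theta * x))) mulrA.
  apply: (@le_trans _ _ ((C + 1) * n.+1%:R ^+ 2 * expR ((c + e) * x) * n.+1%:R ^+ 2)).
    by rewrite ler_wpM2r // ltW.
  have -> : (C + 1) * n.+1%:R ^+ 2 * expR ((c + e) * x) * n.+1%:R ^+ 2 =
    (C + 1) * expR ((c + e) * x) * n.+1%:R ^+ 4 by ring.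
  have -> : c * theta * x = (c + e) * x + e * x by rewrite /e; field.
  rewrite expRD.
  have -> : expR ((c + e) * x) * expR (e * x) * ((C + 1) * K) =
    (C + 1) * expR ((c + e) * x) * (K * expR (e * x)) by ring.
  by rewrite ler_wpM2l ?mulr_ge0 ?expR_ge0 ?addr_ge0 ?(ltW C0) //; exact: hK.
have := ae_eventually_notin (fun n => measurable_confined eta n.+1 (T theta n)) bound.
by apply: filterS.
Qed.

Lemma quenched_limsup eps : 0 < eps -> \forall s \ae P,
  (\forall t \near \oo, (eta t s)%:R <=
     (1 + eps) * c^-1 `^ b^-1 * ln t%:R `^ b^-1) /\
  infinite_set [set t : nat | (eta t s)%:R >=
     (1 - eps) * c^-1 `^ b^-1 * ln t%:R `^ b^-1].
Proof.
move=> e0; have e1 : 0 < 1 + eps by lra.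
have k0 : 0 < (1 + eps)^-1 by rewrite invr_gt0.
have one_powR : 1 = 1 `^ b :> R by rewrite powR1.
have t1 : 0 < (1 + eps)^-1 `^ b < 1.
  rewrite powR_gt0 //= [ltRHS]one_powR gt0_ltr_powR ?nnegrE ?(ltW k0) //.
  by rewrite invf_lt1 //; lra.
have t2 : 1 < (1 + eps) `^ b.
  by rewrite [ltLHS]one_powR gt0_ltr_powR ?nnegrE ?(ltW e1) //; lra.
near=> s; split.
  have [N hN] : exists N, forall n, (N <= n)%N ->
    confined eta n.+1 (T ((1 + eps)^-1 `^ b) n) s.
    by near: s; exact: ae_confined.
  near=> t.
  have t_gt0 : (0 < t)%N by near: t; exact: nbhs_infty_gt.
  have t_pos : 0 < t%:R :> R by rewrite ltr0n.
  rewrite -{1}[1 + eps]invrK; apply: powR_inv_le => //.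
  rewrite -ler_expR lnK ?posrE //; set a := c * _.
  (* Positions up to N only require t to be large. A larger one is m + 1 with N <= m: if t were
     below exp (a (m + 1)^b), confinement to {0, ..., m} would still be in force at time t. *)
  have [tN|] := leqP (eta t s) N.
    apply: (@le_trans _ _ (expR (a * N%:R `^ b))).
      rewrite ler_expR ler_wpM2l ?mulr_ge0 ?powR_ge0 ?(ltW c0) //.
      by rewrite ge0_ler_powR ?nnegrE ?ler_nat // ltW.
    by near: t; exact: nbhs_infty_ger.
  case e : (eta t s) => [//|m]; rewrite ltnS => Nm.
  rewrite leNgt; apply/negP => tm.
  suff /(hN m Nm t) : (t <= T ((1 + eps)^-1 `^ b) m)%N by rewrite e ltnn.
  by rewrite truncn_ge_nat ?expR_ge0 // ltW.
have [N hN] : exists N, forall n, (N <= n)%N ->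
    ~ confined eta n.+1 (T ((1 + eps) `^ b) n) s.
  by near: s; exact: ae_not_confined.
(* If only finitely many times qualified, M would bound the walk at all of them. Leaving {0, ..., n}
   for some n >= M then gives a time k outside the list, and k is shown to qualify. *)
move=> /finite_seqP[X hX].
pose M := (\max_(k <- X) eta k s)%N.
have /existsNP[k /not_implyP[kT /negP]] := hN (maxn N M) (leq_maxl _ _).
rewrite -leqNgt => Mk.
suff : k \in X.
  move=> kX; have : (eta k s <= M)%N by apply: leq_bigmax_seq.
  by move=> kM; have := leq_ltn_trans (leq_maxr N M) Mk; rewrite ltnNge kM.
have : [set` X] k; last by [].
rewrite -hX /=.
apply: (@le_trans _ _ (maxn N M).+1%:R); last by rewrite ler_nat.
set n := maxn N M in Mk kT *.
(* At k = 0 the convention ln 0 = 0 applies. *)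
have lk : 0 <= ln (k%:R : R).
  by case: k {Mk kT} => [|k]; [rewrite ln0|rewrite ln_ge0 ?ler1n].
(* For eps >= 1 the lower bound is at most 0. *)
have [eps1|eps1] := leP 1 eps.
  apply: (@le_trans _ _ 0) => //.
  by rewrite -mulrA mulr_le0_ge0 ?mulr_ge0 ?powR_ge0 //; lra.
have h : c^-1 `^ b^-1 * ln k%:R `^ b^-1 <= (1 + eps) * n.+1%:R.
  apply: le_powR_inv => //.
  case: k {Mk hX lk} kT => [_|k kT].
    by rewrite ln0 // !mulr_ge0 ?powR_ge0 // ltW.
  rewrite -ler_expR lnK ?posrE //.
  by rewrite -truncn_ge_nat ?expR_ge0.
rewrite -mulrA; apply: le_trans (ler_wpM2l _ h) _; first by lra.
by rewrite mulrA ler_piMl //; have := sqr_ge0 eps; rewrite expr2; lra.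
Unshelve. all: end_near. Qed.

End quenched.

(** * Asymptotics of the potential *)

Section environment_potential.
Variable R : realType.

(* The stronger invariant is that the weighted sum dominates the last partial
   sum times the last weight. *)
Lemma abel_sum_ge0 (u a : nat -> R) :
  (forall k, 0 <= a k) -> (forall k, a k.+1 <= a k) ->
  (forall n, 0 <= \sum_(i < n) u i) -> forall n, 0 <= \sum_(i < n) u i * a i.
Proof.
move=> a0 adec u0 n.
have H k : (\sum_(i < k.+1) u i) * a k <= \sum_(i < k.+1) u i * a i.
  elim: k => [|k IH]; first by rewrite !big_ord1.
  rewrite [leRHS]big_ord_recr [in leLHS]big_ord_recr mulrDl lerD2r.
  by apply: le_trans IH; rewrite ler_wpM2l.
case: n => [|n]; first by rewrite big_ord0.
by apply: le_trans (H n); rewrite mulr_ge0.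
Qed.

Lemma abel_sum_le (z a : nat -> R) (e C : R) :
  (forall k, 0 <= a k) -> (forall k, a k.+1 <= a k) -> 0 <= C ->
  (forall n, `|\sum_(i < n) z i| <= e * n%:R + C) ->
  forall n, `|\sum_(i < n) z i * a i| <= e * (\sum_(i < n) a i) + C * a 0%N.
Proof.
(* The sequence w has partial sums e m + C for m >= 1, so w + z and w - z have nonnegative partial
   sums and [abel_sum_ge0] applies to both. *)
move=> a0 adec C0 hz n; pose w i := e + (i == 0%N)%:R * C.
have hw m (f : nat -> R) : (0 < m)%N ->
    \sum_(i < m) w i * f i = e * (\sum_(i < m) f i) + C * f 0%N.
  case: m => // m _; rewrite /w; under eq_bigr do rewrite mulrDl.
  rewrite big_split /= -mulr_sumr; congr (_ + _).
  by rewrite big_ord_recl /= mul1r big1 ?addr0 // => i _; rewrite !mul0r.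
case: n => [|n]; first by rewrite !big_ord0 normr0 mulr0 add0r mulr_ge0.
have hw1 m : (0 < m)%N -> \sum_(i < m) w i = e * m%:R + C.
  move=> m0; have := hw m (fun=> 1) m0; under eq_bigr do rewrite mulr1.
  by rewrite sumr_const card_ord mulr1.
rewrite -hw // ler_norml; apply/andP; split.
  rewrite lerNl -subr_ge0 opprK -big_split /=; under eq_bigr do rewrite -mulrDl.
  apply: (@abel_sum_ge0 (fun i => w i + z i)) => // -[|m]; first by rewrite big_ord0.
  by rewrite big_split /= hw1 //; have := hz m.+1; rewrite ler_norml => /andP[]; lra.
rewrite -subr_ge0 -sumrB /=; under eq_bigr do rewrite -mulrBl.
apply: (@abel_sum_ge0 (fun i => w i - z i)) => // -[|m]; first by rewrite big_ord0.
by rewrite sumrB hw1 //; have := hz m.+1; rewrite ler_norml => /andP[]; lra.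
Qed.

Lemma sum_eventually_le (u a : nat -> R) (K : nat) :
  (forall k, 0 <= a k) -> (forall k, (K <= k)%N -> `|u k| <= a k) ->
  forall n, `|\sum_(i < n) u i| <= \sum_(i < n) a i + \sum_(i < K) `|u i|.
Proof.
move=> a0 ua n; apply: le_trans (ler_norm_sum _ _ _) _.
elim: n => [|n IH]; first by rewrite !big_ord0 add0r sumr_ge0.
have [nK|Kn] := ltnP n K.
  apply: (@le_trans _ _ (\sum_(i < K) `|u i|)); last by rewrite lerDr sumr_ge0.
  rewrite -!(big_mkord xpredT (fun i => `|u i|)).
  by rewrite [leRHS](@big_cat_nat _ _ _ n.+1) //= lerDl sumr_ge0.
by rewrite !big_ord_recr /=; have := ua _ Kn; lra.
Qed.

(* Young's inequality with exponents 1/b and 1/(1 - b). *)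
Lemma powR_tangent (b u v : R) : 0 < b < 1 -> 0 < u -> 0 <= v ->
  v `^ b <= u `^ b + b * u `^ (b - 1) * (v - u).
Proof.
move=> /andP[b0 b1] u0 v0; have b1' : 0 < 1 - b by rewrite subr_gt0.
have x0 : 0 <= v / u by rewrite divr_ge0 // ltW.
have := @conjugate_powR R ((v / u) `^ b) 1 b^-1 (1 - b)^-1 (powR_ge0 _ _) ler01.
rewrite !invr_gt0 !invrK subrKC powR1 mulr1 mul1r -powRrM divff ?gt_eqF //.
rewrite powRr1 // => /(_ b0 b1' erefl).
rewrite -(ler_pM2r (powR_gt0 b u0)) -powRM ?(ltW u0) // divfK ?gt_eqF // => h.
apply: (le_trans h); have e : u `^ b = u * u `^ (b - 1).
  by rewrite mulr_powRB1 // ltW.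
by rewrite e le_eqVlt; apply/orP; left; apply/eqP; field; rewrite gt_eqF.
Qed.

(** The tangent at n + 1, evaluated at n + 2 and at n, places b (n + 1)^{b - 1} between consecutive
    increments of x^b; both bounds telescope. *)
Lemma sum_powR_bounds (b : R) n : 0 < b < 1 ->
  (n.+1%:R `^ b - 1 <= b * \sum_(i < n) i.+1%:R `^ (b - 1) <= n.+1%:R `^ b).
Proof.
move=> b01; have [b0 b1] := andP b01.
have H : n.+1%:R `^ b - 1 <= b * (\sum_(i < n) i.+1%:R `^ (b - 1)) <= n%:R `^ b.
  elim: n => [|n /andP[IH1 IH2]].
    by rewrite big_ord0 powR1 subrr mulr0 lexx powR_ge0.
  rewrite big_ord_recr /= mulrDr; apply/andP; split.
    have := @powR_tangent b n.+1%:R n.+2%:R b01 (ltr0Sn _ _) (ler0n _ _).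
    by rewrite -[n.+2%:R]natr1 addrAC subrr add0r mulr1; lra.
  have := @powR_tangent b n.+1%:R n%:R b01 (ltr0Sn _ _) (ler0n _ _).
  by rewrite -[n.+1%:R]natr1 opprD addNKr mulrN1; lra.
case/andP: H => -> /= /le_trans; apply.
by rewrite ge0_ler_powR ?nnegrE ?ler_nat // ltW.
Qed.

(** The log-odds are odd in y, so the lower bound is the upper bound at -y; the latter comes from ln
    (1 + z) <= z. *)
Lemma ln_odds_le (y : R) : `|y| <= 4^-1 ->
  `|ln ((2^-1 + y) / (1 - (2^-1 + y))) - 4 * y| <= 16 * y ^+ 2.
Proof.
have H (x : R) : `|x| <= 4^-1 ->
    ln ((2^-1 + x) / (2^-1 - x)) <= 4 * x + 16 * x ^+ 2.
  rewrite ler_norml => /andP[x1 x2].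
  have x3 : 0 < 2^-1 - x by lra.
  have e : (2^-1 + x) / (2^-1 - x) = 1 + 2 * x / (2^-1 - x).
    by field; rewrite gt_eqF //; lra.
  have : ln (1 + 2 * x / (2^-1 - x)) <= 2 * x / (2^-1 - x).
    by apply: le_ln1Dx; rewrite ltr_pdivlMr //; lra.
  rewrite e => h; apply: (le_trans h).
  rewrite ler_pdivrMr // -subr_ge0.
  (* The condition |x| <= 1/4 makes the last factor nonnegative. *)
  rewrite (_ : _ - _ = 4 * x ^+ 2 * (1 - 4 * x)); last by field.
  by apply: mulr_ge0; [rewrite mulr_ge0 ?sqr_ge0|lra].
move=> hy; have := H _ hy; have := H (- y); rewrite normrN => /(_ hy).
have -> : 1 - (2^-1 + y) = 2^-1 - y by lra.
move: hy; rewrite opprK sqrrN mulrN ler_norml => /andP[y1 y2].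
have p1 : 0 < 2^-1 + y by lra.
have p2 : 0 < 2^-1 - y by lra.
rewrite !ln_div ?posrE // ler_norml => h1 h2; apply/andP; split; lra.
Qed.

Lemma powRN_small (alpha eta : R) : 0 < alpha -> 0 < eta ->
  exists K : nat, forall k, (K <= k)%N -> k.+1%:R `^ (- alpha) <= eta.
Proof.
move=> al0 eta0; exists (Num.bound (eta^-1 `^ alpha^-1)) => k Kk.
have h : eta^-1 `^ alpha^-1 <= k.+1%:R.
  apply: le_trans (ltW (archi_boundP (powR_ge0 _ _))) _.
  by rewrite ler_nat (leq_trans Kk).
rewrite powRN -[eta]invrK lef_pV2 ?posrE ?invr_gt0 ?powR_gt0 //.
have : (eta^-1 `^ alpha^-1) `^ alpha <= k.+1%:R `^ alpha.
  by rewrite ge0_ler_powR ?nnegrE ?powR_ge0 // ltW.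
by rewrite -powRrM mulVf ?gt_eqF // powRr1 // invr_ge0 ltW.
Qed.

Lemma truncate_id (l h x : R) : l <= x <= h -> truncate l h x = x.
Proof. by move=> /andP[lx xh]; rewrite /truncate ltNge lx ltNge xh. Qed.

Variables (delta alpha : R) (xi y : nat -> R).
Hypothesis delta_range : 0 < delta < 2^-1.
Let p := environment delta alpha xi y.

Lemma environment_bounds n : delta / 2 <= p n <= 1 - delta / 2.
Proof.
have /andP[d0 d1] := delta_range; rewrite /p /environment.
case: ifP => _; first by apply/andP; split; lra.
move: (xi n + _) => z; rewrite /truncate.
have [z1|z1] := ltP z (delta / 2); first by apply/andP; split; lra.
by have [z2|z2] := ltP (1 - delta / 2) z; apply/andP; split; lra.
Qed.

Lemma potential_environment (mu : R) : 0 < alpha < 1 ->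
  (forall k, (0 < k)%N -> xi k = 2^-1) ->
  (forall k, (0 < k)%N -> `|y k| <= 1) ->
  (forall e, 0 < e -> exists2 C, 0 <= C &
    forall n, `|\sum_(i < n) (y i.+1 - mu)| <= e * n%:R + C) ->
  forall e, 0 < e -> exists C, forall n,
    `|potential p n - 4 * mu / (1 - alpha) * n.+1%:R `^ (1 - alpha)| <=
    e * n.+1%:R `^ (1 - alpha) + C.
Proof.
move=> /andP[al0 al1] xiE y1 lln e e0; set b := 1 - alpha.
have b01 : 0 < b < 1 by rewrite /b; lra.
have b0 : 0 < b by lra.
pose a i : R := i.+1%:R `^ (- alpha).
have a0 i : 0 <= a i by exact: powR_ge0.
have adec i : a i.+1 <= a i.
  rewrite /a !powRN lef_pV2 ?posrE ?powR_gt0 //.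
  by rewrite ge0_ler_powR ?nnegrE ?ler_nat // ltW.
(* As the a i sum to at most (n + 1)^b / b, the slopes e b / 2 for the linearisation and 4 (e b / 8)
   for the law of large numbers add up to e. *)
have e1 : 0 < e * b / 2 by rewrite divr_gt0 ?mulr_gt0.
have e2 : 0 < e * b / 8 by rewrite divr_gt0 ?mulr_gt0.
have [C2 C20 hC2] := lln _ e2.
have h2 := @abel_sum_le (fun i => y i.+1 - mu) a _ _ a0 adec C20 hC2.
pose u i := ln (p i.+1 / (1 - p i.+1)) - 4 * (y i.+1 * a i).
(* The bound 1/4 makes [ln_odds_le] applicable and, as delta < 1/2, the truncation inactive; the
   other bound gives 16 a^2 <= (e b / 2) a. *)
have eta0 : 0 < Num.min 4^-1 (e * b / 2 / 16).
  by rewrite lt_min invr_gt0 ltr0n /= divr_gt0.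
have [K hK] := powRN_small al0 eta0.
have hu k : (K <= k)%N -> `|u k| <= e * b / 2 * a k.
  move=> /hK; rewrite -/(a k) le_min => /andP[k1 k2].
  have ya : `|y k.+1 * a k| <= a k.
    by rewrite normrM (ger0_norm (a0 k)) ler_piMl // y1.
  have -> : u k = ln ((2^-1 + y k.+1 * a k) / (1 - (2^-1 + y k.+1 * a k))) -
      4 * (y k.+1 * a k).
    rewrite /u /p /environment /= xiE // -/(a k) truncate_id //.
    have := le_trans ya k1; rewrite ler_norml => /andP[z1 z2].
    by have /andP[d0 d1] := delta_range; apply/andP; split; lra.
  apply: (le_trans (ln_odds_le (le_trans ya k1))).
  apply: (@le_trans _ _ (16 * (a k * a k))).
    rewrite ler_wpM2l // -(real_normK (num_real _)) expr2.
    by rewrite ler_pM.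
  rewrite mulrA ler_wpM2r //; lra.
have h1 := @sum_eventually_le u (fun k => e * b / 2 * a k) K
  (fun k => mulr_ge0 (ltW e1) (a0 k)) hu.
exists (\sum_(i < K) `|u i| + 4 * (C2 * a 0%N) + 4 * `|mu| / b) => n.
have potE : potential p n = \sum_(i < n) u i +
    4 * \sum_(i < n) (y i.+1 - mu) * a i + 4 * mu * \sum_(i < n) a i.
  rewrite /potential big_add1 big_mkord !mulr_sumr -!big_split /=.
  by apply: eq_bigr => i _; rewrite /u; ring.
have := sum_powR_bounds n b01; set A := \sum_(i < n) _; set N := n.+1%:R `^ b.
have AE : \sum_(i < n) a i = A.
  by apply: eq_bigr => i _; rewrite /a; congr (_ `^ _); rewrite /b; ring.
move=> /andP[A1 A2].
have h3 : `|4 * mu * A - 4 * mu / b * N| <= 4 * `|mu| / b.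
  have -> : 4 * mu * A - 4 * mu / b * N = 4 * mu / b * (b * A - N).
    by field; rewrite gt_eqF.
  rewrite normrM -[leRHS]mulr1 ler_pM //.
    by rewrite !normrM normfV normr_nat (gtr0_norm b0).
  by rewrite ler_norml; lra.
have := h1 n; rewrite -mulr_sumr AE => {}h1.
have := h2 n; rewrite AE => {}h2.
have h4 : e * (b * A) <= e * N by rewrite ler_wpM2l // ltW.
rewrite potE AE.
move: h1 h2 h3; rewrite !ler_norml => /andP[h11 h12] /andP[h21 h22] /andP[h31 h32].
apply/andP; split; lra.
Qed.

End environment_potential.

(** * Laws of large numbers *)

Section orthogonal_law_of_large_numbers.
Context d (T : measurableType d) (R : realType) (P : probability T R).

Lemma bounded_integrable (f : T -> R) (M : R) :
  measurable_fun setT f -> (forall x, `|f x| <= M) ->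
  P.-integrable setT (EFin \o f).
Proof.
move=> mf fM; apply: measurable_bounded_integrable => //.
  exact: le_lt_trans (probability_le1 _ _) (ltry _).
by exists M; split; [exact: num_real|move=> N MN x _; exact: le_trans (ltW MN)].
Qed.

Lemma integral_probability_cst (r : R) : (\int[P]_x r%:E = r%:E)%E.
Proof. by have := expectation_cst P r; rewrite unlock. Qed.

Lemma second_moment_tail (f : T -> R) (a : R) : measurable_fun setT f -> 0 < a ->
  (P [set x | (a <= `|f x|)%R] * (a ^+ 2)%:E <= \int[P]_x (f x ^+ 2)%:E)%E.
Proof.
move=> mf a0.
have := @le_integral_comp_abse _ _ _ P setT measurableT
  (fun x => (f x ^+ 2)%:E) (a ^+ 2) id (@measurable_id _ _ setT)
  (fun r r0 => r0) (fun x y _ _ xy => xy).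
have /measurable_EFinP mf2 : measurable_fun setT (fun x => f x ^+ 2).
  exact: measurable_funX.
move=> /(_ mf2 (exprn_gt0 _ a0)); rewrite setTI muleC.
have -> : [set x | ((a ^+ 2)%:E <= `|(f x ^+ 2)%:E|)%E] = [set x | a <= `|f x|].
  apply/seteqP; split => x /=; rewrite lee_fin normrX;
  by rewrite ler_pXn2r ?nnegrE ?(ltW a0).
move=> /le_trans; apply; rewrite le_eqVlt; apply/orP; left.
by apply/eqP; apply: eq_integral => x _; rewrite gee0_abs // lee_fin sqr_ge0.
Qed.

Variables (Z : nat -> T -> R) (M : R).
Hypotheses (mZ : forall i, measurable_fun setT (Z i))
  (ZM : forall i x, `|Z i x| <= M)
  (Zorth : forall i j, i != j -> (\int[P]_x (Z i x * Z j x)%:E = 0)%E).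

Let S n x := \sum_(i < n) Z i x.

Let mS n : measurable_fun setT (S n).
Proof. exact: measurable_sum. Qed.

Let M_ge0 : 0 <= M.
Proof.
have [x _] : [set: T] !=set0.
  apply/set0P/negP => /eqP T0; have := probability_setT P.
  by rewrite T0 measure0 => /eqP; rewrite eqe eq_sym oner_eq0.
exact: le_trans (ZM 0 x).
Qed.

(** Orthogonality removes the cross terms and leaves n squares. *)
Lemma orthogonal_second_moment n :
  (\int[P]_x (S n x ^+ 2)%:E <= (n%:R * M ^+ 2)%:E)%E.
Proof.
have iZZ i j : P.-integrable setT (fun x => (Z i x * Z j x)%:E).
  apply: (@bounded_integrable _ (M * M)); first exact: measurable_funM.
  by move=> x; rewrite normrM ler_pM.
have -> : (\int[P]_x (S n x ^+ 2)%:E = \sum_(i < n) \int[P]_x (Z i x * Z i x)%:E)%E.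
  transitivity (\int[P]_x \sum_(i < n) \sum_(j < n) (Z i x * Z j x)%:E)%E.
    apply: eq_integral => x _; rewrite expr2 /S mulr_suml -sumEFin.
    by apply: eq_bigr => i _; rewrite mulr_sumr -sumEFin.
  rewrite integral_sum //; last first.
    by move=> i; apply: integrable_sum => // j _; exact: iZZ.
  apply: eq_bigr => i _; rewrite integral_sum // (bigD1 i) //= big1 ?adde0 //.
  by move=> j ji; rewrite Zorth // eq_sym.
apply: (@le_trans _ _ (\sum_(i < n) (M ^+ 2)%:E)%E).
  apply: lee_sum => i _.
  rewrite -integral_probability_cst.
  apply: ge0_le_integral => //.
  - by move=> x _; rewrite lee_fin -expr2 sqr_ge0.
  - by apply/measurable_EFinP; exact: measurable_funM.
  - by move=> x _; rewrite lee_fin -expr2 -(real_normK (num_real _)) ler_pXn2r ?nnegrE.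
by rewrite sumEFin sumr_const card_ord mulr_natl.
Qed.

(** Consecutive squares around n are 2 k + 1 apart with k <= sqrt n, so with increments bounded by M
    the values at squares decide the growth. *)
Lemma sqrt_interpolation (s : nat -> R) :
  (forall n, `|s n.+1 - s n| <= M) -> s 0%N = 0 ->
  (forall e, 0 < e -> exists N : nat, forall k, (N <= k)%N ->
     `|s (k.+1 ^ 2)%N| <= e * k.+1%:R ^+ 2) ->
  forall e, 0 < e -> exists2 C, 0 <= C & forall n, `|s n| <= e * n%:R + C.
Proof.
move=> sM s0 hs e e0.
have step m n : `|s (m + n)%N - s m| <= n%:R * M.
  elim: n => [|n IH]; first by rewrite addn0 subrr normr0 mul0r.
  rewrite addnS -(natr1 n) mulrDl mul1r.
  rewrite (_ : _ - _ = (s (m + n).+1 - s (m + n)%N) + (s (m + n)%N - s m)); last by ring.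
  by apply: le_trans (ler_normD _ _) _; rewrite addrC lerD.
have [N hN] := hs _ (divr_gt0 e0 (ltr0Sn _ 1)).
(* The terms come from the squares up to N^2, from completing the square in 2 k M, and from the 1 in
   2 k + 1. *)
exists ((N ^ 2)%:R * M + 2 * M ^+ 2 / e + M).
  by rewrite !addr_ge0 ?mulr_ge0 ?sqr_ge0 ?invr_ge0 // ltW.
move=> n.
have [k /andP[kn nk]] : exists k, (k ^ 2 <= n < k.+1 ^ 2)%N.
  elim: n => [|n [k /andP[k1 k2]]]; first by exists 0%N.
  have [h|h] := leqP (k.+1 ^ 2) n.+1; last by exists k; rewrite h leqW.
  by exists k.+1; rewrite h /=; move: k2; rewrite !expnS !expn0; nia.
have e2 x : 0 <= e / 2 * x ^+ 2.
  by apply: mulr_ge0; [rewrite divr_ge0 // ltW|exact: sqr_ge0].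
have h1 : `|s (k ^ 2)%N| <= e / 2 * k%:R ^+ 2 + (N ^ 2)%:R * M.
  case: k {nk} kn => [_|k kn].
    by rewrite s0 normr0 addr_ge0 ?e2 // mulr_ge0.
  have [Nk|kN] := leqP N k.
    by apply: le_trans (hN k Nk) _; rewrite lerDl mulr_ge0.
  have := step 0%N (k.+1 ^ 2)%N; rewrite add0n s0 subr0 => /le_trans; apply.
  apply: (@le_trans _ _ ((N ^ 2)%:R * M)).
    by rewrite ler_wpM2r // ler_nat leq_exp2r.
  by rewrite lerDr e2.
have h2 : `|s n - s (k ^ 2)%N| <= (2 * k%:R + 1) * M.
  have := step (k ^ 2)%N (n - k ^ 2)%N; rewrite subnKC // => /le_trans; apply.
  rewrite ler_wpM2r // -natrM natr1 ler_nat.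
  by move: nk kn; rewrite !expnS !expn0; nia.
have h3 : 2 * k%:R * M <= e / 2 * k%:R ^+ 2 + 2 * M ^+ 2 / e.
  rewrite -subr_ge0.
  have -> : e / 2 * k%:R ^+ 2 + 2 * M ^+ 2 / e - 2 * k%:R * M =
    e / 2 * (k%:R - 2 * M / e) ^+ 2 by field; rewrite gt_eqF.
  exact: e2.
have h4 : k%:R ^+ 2 <= n%:R :> R by rewrite -natrX ler_nat.
have h5 : e * k%:R ^+ 2 <= e * n%:R by rewrite ler_wpM2l // ltW.
have : `|s n| <= `|s n - s (k ^ 2)%N| + `|s (k ^ 2)%N|.
  by rewrite -{1}[s n](subrK (s (k ^ 2)%N)) ler_normD.
by move: h1 h2 h3 h5; set K := k%:R; set s1 := `|_|; lra.
Qed.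

(** Chebyshev bounds the probability of a deviation along squares by a constant over (k + 1)^2,
    which is summable; [sqrt_interpolation] fills the gaps. *)
Lemma orthogonal_lln : \forall x \ae P, forall e, 0 < e ->
  exists2 C, 0 <= C & forall n, `|S n x| <= e * n%:R + C.
Proof.
(* The tolerances 1/(m + 1) are countably many, so one null set serves every e. *)
pose F m k := [set x | m.+1%:R^-1 * k.+1%:R ^+ 2 <= `|S (k.+1 ^ 2)%N x|].
have mF m k : measurable (F m k).
  rewrite -[F m k]setTI; apply: measurable_fun_le => //.
  exact: measurableT_comp.
have hF m : \forall x \ae P, exists N, forall k, (N <= k)%N -> ~ F m k x.
  apply: (@ae_eventually_notin _ _ _ P (F m) 0%N (m.+1%:R ^+ 2 * M ^+ 2)) => // k _.
  have k0 : 0 < k.+1%:R :> R by [].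
  have a0 : 0 < m.+1%:R^-1 * k.+1%:R ^+ 2 :> R.
    by rewrite mulr_gt0 ?invr_gt0 ?exprn_gt0.
  have := le_trans (second_moment_tail (mS (k.+1 ^ 2)) a0)
    (orthogonal_second_moment (k.+1 ^ 2)%N).
  rewrite -/(F m k) -[P (F m k)]fineK ?fin_num_measure // -EFinM lee_fin.
  rewrite natrX -ler_pdivlMr ?exprn_gt0 // => /le_trans; apply.
  by rewrite le_eqVlt; apply/orP; left; apply/eqP; field; rewrite !gt_eqF.
have := ae_foralln hF; apply: filterS => x hx.
apply: sqrt_interpolation => [n||e e0].
- by rewrite /S big_ord_recr /= addrAC subrr add0r.
- by rewrite /S big_ord0.
have [N hN] := hx (Num.bound e^-1); exists N => k /hN /negP.
rewrite -ltNge => /ltW /le_trans; apply.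
rewrite ler_wpM2r ?sqr_ge0 // -[leRHS]invrK lef_pV2 ?posrE ?invr_gt0 //.
apply: le_trans (ltW (archi_boundP _)) _; first by rewrite invr_ge0 ltW.
by rewrite ler_nat.
Qed.

End orthogonal_law_of_large_numbers.

(** * Expectations of functions of i.i.d. variables *)

Section iid_sequences.
Context d (T : measurableType d) (R : realType) (P : probability T R).

Lemma iid_comp d1 d2 (U : measurableType d1) (V : measurableType d2)
    (X : nat -> T -> U) (f : U -> V) :
  measurable_fun setT f -> iid P X -> iid P (fun i => f \o X i).
Proof.
move=> mf [indep ident]; have mfB B : measurable B -> measurable (f @^-1` B).
  by move=> mB; rewrite -[X in measurable X]setTI; exact: mf.
split=> [J B uJ JI mB|i j B i0 j0 mB].
  by apply: (indep J (fun i => f @^-1` B i)) => // i; exact: mfB.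
by apply: (ident i j (f @^-1` B)) => //; exact: mfB.
Qed.

Lemma probability1_ae (A : set T) : measurable A -> P A = 1%E ->
  \forall x \ae P, A x.
Proof.
move=> mA PA; exists (~` A); split; [exact: measurableC| |by []].
by rewrite probability_setC // PA subee.
Qed.

Variable X : nat -> {RV P >-> R}.
Hypothesis X_iid : iid P (fun i => X i : T -> R).

Variables (phi : R -> R) (M : R).
Hypotheses (mphi : measurable_fun setT phi) (phiM : forall x, `|phi x| <= M).

Let mphiX i : measurable_fun setT (phi \o X i).
Proof. exact: measurableT_comp. Qed.

Let iphiX i : P.-integrable setT (EFin \o (phi \o X i)).
Proof. by apply: (@bounded_integrable _ _ _ _ _ M) => // x; exact: phiM. Qed.

Lemma iid_integral i j : (0 < i)%N -> (0 < j)%N ->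
  (\int[P]_x (phi (X i x))%:E = \int[P]_x (phi (X j x))%:E)%E.
Proof.
move=> i0 j0; have mp : measurable_fun setT (EFin \o phi) by exact/measurable_EFinP.
have := integral_distribution mp (iphiX i).
have := integral_distribution mp (iphiX j) => /= <- <-.
apply: eq_measure_integral => B mB _; exact: X_iid.2.
Qed.

(** Independence identifies the joint law with the product measure on rectangles, hence everywhere,
    and Fubini factorises the integral. *)
Lemma iid_integralM i j : (0 < i)%N -> (0 < j)%N -> i != j ->
  (\int[P]_x (phi (X i x) * phi (X j x))%:E =
   \int[P]_x (phi (X i x))%:E * \int[P]_x (phi (X j x))%:E)%E.
Proof.
move=> i0 j0 ij.
have mXX : measurable_fun setT (fun x => (X i x, X j x)).
  by apply: measurable_fun_pair.
pose m1 := distribution P (X i); pose m2 := distribution P (X j).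
pose f (z : R * R) := phi z.1 * phi z.2.
have mf : measurable_fun setT f.
  by apply: measurable_funM; apply: measurableT_comp.
have indep A B : measurable A -> measurable B ->
    pushforward P (fun x => (X i x, X j x)) (A `*` B) = (m1 A * m2 B)%E.
  move=> mA mB.
  have := X_iid.1 [:: i; j] (fun k => if k == i then A else B).
  rewrite /= inE ij => /(_ isT); rewrite big_cons big_seq1 eqxx.
  rewrite [j == i]eq_sym (negPf ij) => <-.
  - rewrite /pushforward; congr (P _); apply/seteqP; split => x /=.
      move=> [Ai Bj] k /=; rewrite !inE => /orP[]/eqP -> /=; first by rewrite eqxx.
      by rewrite [j == i]eq_sym (negPf ij).
    move=> h; split; first by have := h i (mem_head _ _); rewrite /= eqxx.
    have := h j; rewrite /= !inE eqxx orbT => /(_ isT).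
    by rewrite [j == i]eq_sym (negPf ij).
  - by move=> k /=; rewrite !inE => /orP[]/eqP ->.
  - by move=> k; case: ifP.
have key := product_measure_unique indep.
have mEf : measurable_fun setT (EFin \o f) by exact/measurable_EFinP.
have fM z : `|f z| <= M * M by rewrite normrM ler_pM.
have iphi k : (distribution P (X k)).-integrable setT (EFin \o phi).
  exact: (@bounded_integrable _ _ _ (distribution P (X k)) phi M).
have mp : measurable_fun setT (EFin \o phi) by exact/measurable_EFinP.
have iP := integral_distribution mp (iphiX _).
transitivity (\int[pushforward P (fun x => (X i x, X j x))]_z (f z)%:E)%E.
  rewrite integral_pushforward //.
  apply: (@bounded_integrable _ _ _ _ _ (M * M)) => [|x]; last exact: fM.
  by apply: measurable_funM; exact: mphiX.
transitivity (\int[m1 \x m2]_z (f z)%:E)%E.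
  by apply: eq_measure_integral => A mA _; exact/esym/key.
have prodP : ((m1 \x m2) [set: R * R] < +oo)%E.
  have -> : ((m1 \x m2) [set: R * R] = P [set: T])%E by exact: key.
  exact: le_lt_trans (probability_le1 P _) (ltry _).
rewrite -integral12_prod_meas1; last first.
  apply: measurable_bounded_integrable => //.
  exists (M * M); split; [exact: num_real|move=> N MN z _].
  exact: le_trans (fM z) (ltW MN).
have <- := iP i; have <- := iP j; rewrite -/m1 -/m2 /=.
transitivity (\int[m1]_x ((phi x)%:E * \int[m2]_y (phi y)%:E))%E.
  apply: eq_integral => x _; rewrite /fubini_F /f /=.
  under eq_integral do rewrite EFinM.
  by rewrite integralZl //; exact: iphi.
have [c ->] : exists c, (\int[m2]_y (phi y)%:E = c%:E)%E.
  exists (fine (\int[m2]_y (phi y)%:E)%E); rewrite fineK //.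
  exact: integrable_fin_num (iphi j).
by rewrite integralZr //; exact: iphi.
Qed.

End iid_sequences.

(** * Strong law for the sequence Y *)

Section iid_law_of_large_numbers.
Context d (T : measurableType d) (R : realType) (P : probability T R).
Variable Y : nat -> {RV P >-> R}.
Hypotheses (Y_iid : iid P (fun i => Y i : T -> R))
  (Y_range : P [set x | -1 <= Y 1%N x <= 1] = 1%E).

(* Almost surely [clip] does not change Y, but it is bounded everywhere, as
   [orthogonal_lln] requires. *)
Let clip (x : R) := Num.max (-1) (Num.min x 1).

Let measurable_clip : measurable_fun setT clip.
Proof.
apply: measurable_maxr; first exact: measurable_cst.
by apply: measurable_minr; [exact: measurable_id|exact: measurable_cst].
Qed.

Let clip_le x : `|clip x| <= 1.
Proof. by rewrite ler_norml /clip le_max lexx /= ge_max ge_min lexx orbT andbT; lra. Qed.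

Let clip_id x : -1 <= x <= 1 -> clip x = x.
Proof. by move=> /andP[x1 x2]; rewrite /clip min_l // max_r. Qed.

Lemma iid_ae_range : \forall x \ae P, forall i, (0 < i)%N -> -1 <= Y i x <= 1.
Proof.
have H i : \forall x \ae P, (0 < i)%N -> -1 <= Y i x <= 1.
  case: i => [|i]; first by apply: nearW => x.
  have e j : [set x | -1 <= Y j x <= 1] = Y j @^-1` `[-1, 1]%classic.
    by apply/seteqP; split => x /=; rewrite in_itv.
  have m1 : measurable (`[-1, 1]%classic : set R) by exact: measurable_itv.
  have : \forall x \ae P, [set x | -1 <= Y i.+1 x <= 1] x.
    apply: probability1_ae.
      by rewrite e -[X in measurable X]setTI; exact: measurable_funP.
    by rewrite -Y_range !e; apply: Y_iid.2.
  by apply: filterS.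
exact: ae_foralln H.
Qed.

Let iclip : P.-integrable setT (EFin \o (clip \o Y 1%N)).
Proof.
apply: (@bounded_integrable _ _ _ _ _ 1) => [|x]; last exact: clip_le.
exact: (measurableT_comp measurable_clip (measurable_funP (Y 1%N))).
Qed.

Let expectation_clip : ('E_P[Y 1%N] = \int[P]_x (clip (Y 1%N x))%:E)%E.
Proof.
rewrite unlock; apply: ae_eq_integral => //.
- exact/measurable_EFinP.
- exact/measurable_EFinP/measurableT_comp.
- by apply: filterS iid_ae_range => x /(_ 1%N isT) h _ /=; rewrite clip_id.
Qed.

(** This makes [fine] return the actual mean and not the default value 0. *)
Lemma iid_expectation_fin_num : ('E_P[Y 1%N] \is a fin_num)%E.
Proof. by rewrite expectation_clip; exact: integrable_fin_num iclip. Qed.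

Lemma iid_lln : \forall x \ae P, forall e, 0 < e -> exists2 C, 0 <= C &
  forall n, `|\sum_(i < n) (Y i.+1 x - fine 'E_P[Y 1%N])| <= e * n%:R + C.
Proof.
set mu := fine _.
(* Centring after clipping gives a function bounded everywhere, with mean 0 since clipping does not
   change the expectation. *)
pose phi x := clip x - mu.
have mphi : measurable_fun setT phi by apply: measurable_funB.
have phiM x : `|phi x| <= 1 + `|mu|.
  by apply: le_trans (ler_normB _ _) _; rewrite lerD2r.
have Eclip : (\int[P]_x (clip (Y 1%N x))%:E = mu%:E)%E.
  by rewrite -expectation_clip /mu fineK // iid_expectation_fin_num.
have phi0 i : (\int[P]_x (phi (Y i.+1 x))%:E = 0)%E.
  rewrite (@iid_integral _ _ _ _ _ Y_iid phi _ mphi phiM i.+1 1%N) //.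
  under eq_integral do rewrite EFinB.
  rewrite integralB //; last by apply: finite_measure_integrable_cst.
  by rewrite Eclip integral_probability_cst subee.
have orth i j : i != j ->
    (\int[P]_x (phi (Y i.+1 x) * phi (Y j.+1 x))%:E = 0)%E.
  by move=> ij; rewrite (@iid_integralM _ _ _ _ _ Y_iid phi _ mphi phiM) // phi0 mul0e.
have := @orthogonal_lln _ _ _ P (fun i x => phi (Y i.+1 x)) _
  (fun i => measurableT_comp mphi (measurable_funP (Y i.+1)))
  (fun i x => phiM (Y i.+1 x)) orth.
apply: filterS2 iid_ae_range => x hY h e e0; have [C C0 hC] := h e e0.
exists C => // n; have -> // : \sum_(i < n) (Y i.+1 x - mu) =
  \sum_(i < n) phi (Y i.+1 x).
by apply: eq_bigr => i _; rewrite /phi clip_id // hY.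
Qed.

End iid_law_of_large_numbers.

(** * Conclusion for almost every environment *)

Theorem theorem8 (R : realType) (d : measure_display) (Omega : measurableType d)
  (Pr : probability Omega R) (delta alpha : R)
  (xi Y : nat -> {RV Pr >-> R}) (r : nat)
  (delta_range : 0 < delta < 2^-1)
  (alpha_gt0 : 0 < alpha)
  (xiY_iid : iid Pr (fun i w => (xi i w, Y i w)))
  (xi_range : Pr [set w | delta <= xi 1%N w <= 1 - delta] = 1%E)
  (Y_range : Pr [set w | -1 <= Y 1%N w <= 1] = 1%E)
  (xi_half : Pr [set w | xi 1%N w = 2^-1] = 1%E)
  (EY_gt0 : (0 < 'E_Pr[Y 1%N])%E)
  (VY_range : (0 < 'V_Pr[Y 1%N] < +oo)%E)
  (alpha_lt1 : alpha < 1) :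
  \forall w \ae Pr,
    forall (d' : measure_display) (S : measurableType d') (P : probability S R)
      (eta : nat -> {RV P >-> nat}),
    markov_chain
      (transition (environment delta alpha (fun n => xi n w) (fun n => Y n w)))
      r eta ->
    forall eps : R, 0 < eps ->
    \forall s \ae P,
      (\forall t \near \oo,
        (eta t s)%:R <= (1 + eps)
          * ((1 - alpha) / (4 * fine 'E_Pr[Y 1%N])) `^ (1 - alpha)^-1
          * ln t%:R `^ (1 - alpha)^-1) /\
      infinite_set [set t : nat |
        (eta t s)%:R >= (1 - eps)
          * ((1 - alpha) / (4 * fine 'E_Pr[Y 1%N])) `^ (1 - alpha)^-1
          * ln t%:R `^ (1 - alpha)^-1].
Proof.
pose b := 1 - alpha; pose mu := fine 'E_Pr[Y 1%N]; pose c := 4 * mu / b.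
have b0 : 0 < b by rewrite subr_gt0.
have /andP[d0 d1] := delta_range.
have xi_iid : iid Pr (fun i => xi i : Omega -> R).
  exact: (iid_comp (@measurable_fst _ _ R R) xiY_iid).
have Y_iid : iid Pr (fun i => Y i : Omega -> R).
  exact: (iid_comp (@measurable_snd _ _ R R) xiY_iid).
have xi_ae : \forall w \ae Pr, forall i, (0 < i)%N -> xi i w = 2^-1.
  apply: ae_foralln => -[|i]; first by apply: nearW => w.
  have m1 : measurable ([set 2^-1] : set R) by exact: measurable_set1.
  have : \forall w \ae Pr, (xi i.+1 @^-1` [set 2^-1]) w.
    apply: probability1_ae.
      by rewrite -[X in measurable X]setTI; exact: measurable_funP.
    by rewrite -[RHS]xi_half; apply: xi_iid.2.
  by apply: filterS.
have mu0 : 0 < mu.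
  by rewrite -lte_fin fineK // iid_expectation_fin_num.
have c0 : 0 < c by rewrite divr_gt0 // mulr_gt0.
have cE : (1 - alpha) / (4 * fine 'E_Pr[Y 1%N]) = c^-1.
  by rewrite /c invf_div.
(* The almost sure properties below are fixed before the chain is introduced, so the exceptional set
   depends neither on its probability space nor on eps. *)
near=> w.
have xiw : forall i, (0 < i)%N -> xi i w = 2^-1 by near: w.
have Yw : forall i, (0 < i)%N -> -1 <= Y i w <= 1.
  by near: w; exact: iid_ae_range.
have llnw : forall e, 0 < e -> exists2 C, 0 <= C &
    forall n, `|\sum_(i < n) (Y i.+1 w - mu)| <= e * n%:R + C.
  by near: w; exact: iid_lln.
move=> d' S P eta eta_markov eps eps0; rewrite cE.
have bounds := environment_bounds alpha (fun n => xi n w) (fun n => Y n w) delta_range.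
(* The truncation gives 1 - p x >= delta / 2. *)
apply: (quenched_limsup (kappa := delta / 2) _ _ _ b0 c0 _ eta_markov eps0).
- by move=> x; have /andP[? ?] := bounds x; apply/andP; split; lra.
- by rewrite divr_gt0.
- by move=> x; have /andP[? ?] := bounds x; lra.
- apply: potential_environment => //; first by rewrite alpha_gt0.
  by move=> k /Yw; rewrite ler_norml.
Unshelve. all: end_near. Qed.
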